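(* Let $X$ be a set with $|X|\ge 3$. For any integer $n\ge 3$, let $p$ be the least odd prime divisor of $n-1$ if $n-1$ is not a power of $2$; otherwise, set $p=4$. The following assertions hold. (a) If $n$ is even, then $\mathcal{F}^n_{n-1}\setminus\mathcal{F}^n_1\neq\varnothing$ if and only if $|X|\ge p$. (b) If $n$ is odd, then $\mathcal{F}^n_{n-1}\setminus\mathcal{F}^n_1\neq\varnothing$ if and only if $|X|\ge\min(4,p)$.
   Context: An operation $F\colon X^n\to X$ is associative if $F(x_1,\ldots,x_{i-1},F(x_i,\ldots,x_{i+n-1}),x_{i+n},\ldots,x_{2n-1})=F(x_1,\ldots,x_i,F(x_{i+1},\ldots,x_{i+n}),x_{i+n+1},\ldots,x_{2n-1})$ for all $x_1,\ldots,x_{2n-1}\in X$ and $1\le i\le n-1$. For $k\in\{1,\ldots,n\}$, $\mathcal{F}^n_k$ is the class of associative operations $F\colon X^n\to X$ such that $F(x_1,\ldots,x_n)\in\{x_1,\ldots,x_n\}$ whenever at least $k$ of the components $x_1,\ldots,x_n$ are equal to each other. *)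

(* Defs.v *)
From mathcomp Require Import all_boot.
From mathcomp Require Import boolp classical_sets functions cardinality.

Set Implicit Arguments.
Unset Strict Implicit.
Unset Printing Implicit Defensive.

Local Open Scope classical_set_scope.

Section Operations.
Variables (X : Type) (n : nat).
Implicit Types (F : n.-tuple X -> X).

(* For 0-based i < n, the argument list
     (x_0, ..., x_(i-1), F (x_i, ..., x_(i+n-1)), x_(i+n), ..., x_(2n-2)).
   Although x is a sequence indexed by nat, only its terms of index < 2n-1
   are used. *)
Definition nest F (x : nat -> X) (i : nat) : n.-tuple X :=
  [tuple if j < i then x j
         else if j == i :> nat then F [tuple x (i + l) | l < n]
         else x (j + n.-1) | j < n].

Definition nary_associative F : Prop :=
  forall (x : nat -> X) (i : nat), i.+1 < n ->
    F (nest F x i) = F (nest F x i.+1).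

Definition at_least_equal (k : nat) (x : n.-tuple X) : Prop :=
  exists2 A : {set 'I_n}, k <= #|A| &
    {in A &, forall i j, tnth x i = tnth x j}.

Definition opclass (k : nat) : set (n.-tuple X -> X) :=
  [set F | nary_associative F /\
    forall x : n.-tuple X, at_least_equal k x -> exists i, F x = tnth x i].

End Operations.

Arguments opclass : clear implicits.

Definition power_of_two (m : nat) : Prop := exists e : nat, m = 2 ^ e.

Definition least_odd_prime_divisor (m p : nat) : Prop :=
  [/\ prime p, odd p, p %| m &
      forall q : nat, prime q -> odd q -> q %| m -> p <= q].

Definition is_critical (n p : nat) : Prop :=
  (~ power_of_two n.-1 -> least_odd_prime_divisor n.-1 p) /\
  (power_of_two n.-1 -> p = 4).

Definition card_at_least (X : Type) (m : nat) : Prop := (`I_m #<= [set: X])%card.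

(* Main.v *)
Require Import Defs.
From HB Require Import structures.
From mathcomp Require Import all_boot ssralg zmodp zify.
From mathcomp Require Import boolp classical_sets functions cardinality.

(* By Post's coset theorem, X embeds in a monoid in which F becomes the n-fold
   product. Put m = n - 1. Membership of F in F^n_m makes every a ^ m an
   idempotent, and for a, b in X either a ^ m = b ^ m, or ab = aa, or ab = bb.
   Hence every product of n elements of X equals a product of n of the same
   elements that share a single idempotent e. The elements of X with
   idempotent e commute and form a coset of an abelian group whose exponent
   divides m. If F is not quasitrivial, some such coset contains two factors of
   a product together with the value of that product, hence at least three
   elements. A nontrivial abelian group of odd exponent dividing m has at least
   p elements, and one with at least three elements either has a fourth or has
   order 3, in which case 3 divides m.
   Conversely, embed Z/p or (Z/2)^2 in X and let all the other points of X
   absorb from the left. *)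

Set Implicit Arguments.
Unset Strict Implicit.
Unset Printing Implicit Defensive.

Local Open Scope classical_set_scope.

(** * Products in a monoid and the idempotents of their factors *)

Section ProductsInMonoids.
Local Open Scope group_scope.
Variable S : monoidType.
Implicit Types (A B P : set S) (m k : nat).

Fixpoint is_product P k (s : S) : Prop :=
  if k is k'.+1 then exists x s', [/\ P x, is_product P k' s' & s = x * s']
  else s = 1.

Lemma is_product_sub P Q k s : P `<=` Q -> is_product P k s -> is_product Q k s.
Proof.
move=> PQ; elim: k s => [//|k IH] s [x [s' [Px Ps' ->]]].
by exists x, s'; split; [exact: PQ | exact: IH |].
Qed.

Lemma is_productM P k l s t :
  is_product P k s -> is_product P l t -> is_product P (k + l) (s * t).
Proof.
move=> + Pt; elim: k s => [|k IH] s /=; first by move=> ->; rewrite mul1g.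
by move=> [x [s' [Px /IH Ps' ->]]]; exists x, (s' * t); rewrite mulgA.
Qed.

Lemma is_productX P k s : P s -> is_product P k (s ^+ k).
Proof.
move=> Ps; elim: k => [//|k IH]; exists s, (s ^+ k); split=> //.
by rewrite expgS.
Qed.

Lemma is_product_const P k s a :
  (forall b, P b -> b = a) -> is_product P k s -> s = a ^+ k.
Proof.
move=> Pa; elim: k s => [//|k IH] s [x [s' [/Pa -> /IH -> ->]]].
by rewrite expgS.
Qed.

Lemma is_product_commute P k s x :
  (forall y, P y -> commute x y) -> is_product P k s -> commute x s.
Proof.
move=> Px; elim: k s => [s ->|k IH s [y [s' [/Px xy /IH xs' ->]]]].
  exact: commute1.
exact: commuteM.
Qed.

Lemma is_product_ord P k (x : 'I_k -> S) :
  (forall i, P (x i)) -> is_product P k (\prod_(i < k) x i).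
Proof.
elim: k x => [|k IH] x Px; first by rewrite /= big_ord0.
exists (x ord0), (\prod_(i < k) x (lift ord0 i)); split=> //; first exact: IH.
by rewrite big_ord_recl.
Qed.

(* The trace on [A] of the condition defining [opclass X m.+1 m]. *)
Definition near_constant_trivial m A : Prop :=
  forall a b k, A a -> A b -> k <= m ->
    a ^+ k * b * a ^+ (m - k) = a \/ a ^+ k * b * a ^+ (m - k) = b.

Section Fixed.
Variables (m : nat) (A : set S).
Hypotheses (m_gt1 : 1 < m) (Atriv : near_constant_trivial m A).

Lemma triv_expS a : A a -> a ^+ m.+1 = a.
Proof.
move=> Aa; have := Atriv Aa Aa (leq0n m).
by rewrite subn0 expg0 mul1g -expgS; case.
Qed.

Lemma triv_exp_mul a : A a -> a ^+ m * a = a.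
Proof. by move=> /triv_expS; rewrite expgSr. Qed.

Lemma triv_mul_exp a : A a -> a * a ^+ m = a.
Proof. by move=> /triv_expS; rewrite expgS. Qed.

Lemma triv_exp_idem a : A a -> a ^+ m * a ^+ m = a ^+ m.
Proof.
move=> Aa; rewrite -[in RHS](prednK (ltnW m_gt1)) -[in X in _ * X](prednK (ltnW m_gt1)).
by rewrite !expgS mulgA triv_exp_mul.
Qed.

Lemma triv_left a b : A a -> A b -> a ^+ m * b = a \/ a ^+ m * b = b.
Proof. by move=> Aa Ab; have := Atriv Aa Ab (leqnn m); rewrite subnn mulg1. Qed.

Lemma triv_right a b : A a -> A b -> a * b ^+ m = a \/ a * b ^+ m = b.
Proof.
move=> Aa Ab; have := Atriv Ab Aa (leq0n m).
by rewrite subn0 mul1g => -[]; [right|left].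
Qed.

(** For a factor [y], triviality leaves [a ^+ m * y] equal to [a] or [y]. The value [y] would give
    [a ^+ m * e = e], whereas [a * e = a] gives [a ^+ m * e = a ^+ m]. So [a * y = a * a] for each
    factor in turn. *)
Lemma is_product_absorb (e a : S) k s : A a -> a ^+ m != e -> a * e = a ->
    is_product [set x | A x /\ x ^+ m = e] k s ->
  a * s = a ^+ k.+1.
Proof.
move=> Aa ae Eae; elim: k s => [|k IH] s; first by move=> /= ->; rewrite mulg1.
move=> [y [s' [[Ay ye] /IH as' ->]]].
have aay : a ^+ m * y = a.
  case: (triv_left Aa Ay) => // ay.
  have m0 := ltnW m_gt1.
  case/eqP: ae; transitivity (a ^+ m * e).
    by rewrite -{2}(prednK m0) expgSr -mulgA Eae -expgSr prednK.
  by rewrite -ye -{2 3}(prednK m0) expgS mulgA ay.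
have ay : a * y = a * a by rewrite -{1}(triv_mul_exp Aa) -mulgA aay.
by rewrite mulgA ay -mulgA as' -expgS.
Qed.

(** Induction on the length: if the first factor [x] has an idempotent other than the common one [e]
    of the rest, then either [x] absorbs the rest and the product is a power of [x], or [x] may be
    replaced by the next factor [y]. *)
Lemma is_product_uniform P k s : P `<=` A -> 0 < k -> is_product P k s ->
  exists e, is_product [set x | P x /\ x ^+ m = e] k s.
Proof.
move=> PA; elim: k s => [//|[|k] IH] s _ [x [s' [Px Ps' ->]]].
  by exists (x ^+ m), x, s'.
have [//|e Es'] := IH s' _ Ps'; have Ax := PA _ Px.
have [xe|xe] := eqVneq (x ^+ m) e; first by exists e, x, s'.
have As' : is_product [set y | A y /\ y ^+ m = e] k.+1 s'.
  by apply: is_product_sub Es' => y [/PA].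
have [y [t [[Py ye] Pt s'E]]] := Es'.
case: (triv_right Ax (PA _ Py)) => xy.
  exists (x ^+ m); rewrite (@is_product_absorb e x k.+1) //.
    exact: is_productX.
  by rewrite -ye.
exists e, y, s'; split=> //.
by rewrite s'E mulgA -{1}(triv_exp_mul (PA _ Py)) mulgA xy -mulgA.
Qed.

(** Triviality at [k = 1], multiplied on the right by [a], gives [a * b = b * a] or [a * b = a * a];
    in the second case cancelling [a] yields [b = a]. *)
Lemma triv_commute a b : A a -> A b -> a ^+ m = b ^+ m -> commute a b.
Proof.
move=> Aa Ab ab; have m1 := ltnW m_gt1.
have H c : a * b * a ^+ (m - 1) = c -> a * b = c * a.
  move=> <-; rewrite -[RHS]mulgA -expgSr subn1 prednK // ab.
  by rewrite -mulgA triv_mul_exp.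
have /(_ 1%N m1)[/H|/H//] := Atriv Aa Ab.
move=> /(congr1 (fun z => a ^+ m.-1 * z)); rewrite !mulgA -expgSr prednK //.
by rewrite triv_exp_mul // {1}ab triv_exp_mul // => ->.
Qed.

Lemma is_product_uniformX e k s :
    is_product [set x | A x /\ x ^+ m = e] k.+1 s ->
  s ^+ m = e.
Proof.
elim: k s => [|k IH] s [x [s' [[Ax xe] Ps' ->]]].
  by rewrite Ps' mulg1.
rewrite expgMn ?(IH _ Ps') ?xe; first by rewrite -xe triv_exp_idem.
apply: (@is_product_commute _ k.+1) Ps' => y [Ay ye].
by apply: triv_commute; rewrite ?xe ?ye.
Qed.

(* [a] and [b] are two of the factors of [g]. *)
Lemma nontrivial_product P g : P `<=` A -> A g ->
    is_product P m.+1 g -> ~ P g ->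
  exists a b, [/\ A a, A b, a ^+ m = g ^+ m /\ b ^+ m = g ^+ m
                & [/\ a != b, a != g & b != g]].
Proof.
move=> PA Ag Pg ng; have [//|e Eg] := is_product_uniform PA _ Pg.
have ge : g ^+ m = e.
  apply: (@is_product_uniformX e m) => //.
  by apply: is_product_sub Eg => y [/PA].
have [a [_ [[Pa ae] _ _]]] := Eg.
have [[b [Pb be ab]]|nb] := pselect (exists b, [/\ P b, b ^+ m = e & a != b]).
  exists a, b; split; rewrite ?ge //; try exact: PA.
  by split=> //; apply/eqP => E; apply: ng; rewrite -E.
(* All factors of the uniform product equal [a], so [g = a ^+ m.+1 = a] lies in [P]. *)
case: ng; rewrite (_ : g = a) //.
rewrite -(triv_expS (PA _ Pa)); apply: is_product_const Eg => b [Pb be].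
by apply: contrapT => /eqP ba; apply: nb; exists b; rewrite eq_sym.
Qed.

(** * Cancellation and counting inside one coset *)

Lemma triv_exp_mulI (x y z : S) k : x ^+ m * y = y -> x ^+ m * z = z ->
  x ^+ k * y = x ^+ k * z -> y = z.
Proof.
move=> xy xz /(congr1 (fun w => x ^+ (m.-1 * k) * w)).
rewrite !mulgA -expgnDr -mulSnr prednK ?(ltnW m_gt1)// expgnA.
by elim: k => [|k IH]; rewrite ?mul1g // !expgSr -!mulgA xy xz.
Qed.

Lemma triv_mulI (a b c : S) : A b -> A c -> a ^+ m = b ^+ m -> a ^+ m = c ^+ m ->
  a * b = a * c -> b = c.
Proof.
move=> Ab Ac ab ac; apply: (@triv_exp_mulI a b c 1).
  by rewrite ab triv_exp_mul.
by rewrite ac triv_exp_mul.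
Qed.

Lemma triv_exp_mulX (a : S) k : A a -> 0 < k -> a ^+ m * a ^+ k = a ^+ k.
Proof. by case: k => // k Aa _; rewrite expgS mulgA triv_exp_mul. Qed.

Section Coset.
Variables a b : S.
Hypotheses (Aa : A a) (Ab : A b) (ab : a ^+ m = b ^+ m).

(** By Bézout [u * d = v * m + 1], so [c ^+ (u * d) * c ^+ m = c] for [c] in [A]: the [d]th power
    and the idempotent determine the element. *)
Lemma coset_exp_coprime d : b ^+ d = a ^+ d -> coprime d m -> 0 < d -> a = b.
Proof.
move=> bad /coprimeP H d0; have [[u v] /= uv] := H d0.
have bu : b ^+ (u * d) = a ^+ (u * d) by rewrite mulnC !expgnA bad.
have E c : A c -> c ^+ (u * d) * c ^+ m = c * c ^+ m.
  move=> Ac; have -> : (u * d = (v * m).+1)%N by lia.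
  rewrite expgS -mulgA mulnC expgnA; congr (_ * _).
  elim: v {uv bu} => [|v IH]; first by rewrite expg0 mul1g.
  by rewrite expgS -mulgA IH triv_exp_idem.
by rewrite -[LHS](triv_mul_exp Aa) -E // -bu ab E // triv_mul_exp.
Qed.

(* [b ^+ k * a ^+ (m.+1 - k)] is the [k]th multiple of [b] in the group obtained
   by choosing [a] as origin. *)
Lemma coset_multiples_inj p : a != b -> p <= m.+1 ->
    (forall d, 0 < d -> d < p -> coprime d m) ->
  {in `I_p &, injective (fun k => b ^+ k * a ^+ (m.+1 - k))}.
Proof.
move=> /eqP nab pm cop.
have cab : commute a b by exact: triv_commute.
have H k l : k < l -> l < p ->
    b ^+ k * a ^+ (m.+1 - k) <> b ^+ l * a ^+ (m.+1 - l).
  move=> kl lp; pose d := (l - k)%N; pose r := (m.+1 - l)%N.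
  have d0 : 0 < d by rewrite subn_gt0.
  have -> : (m.+1 - k = r + d)%N by rewrite /r /d; lia.
  have cX i j : a ^+ i * b ^+ j = b ^+ j * a ^+ i by exact: commuteX2.
  have fixX t : a ^+ m * t = t -> a ^+ m * (b ^+ k * t) = b ^+ k * t.
    by move=> at_; rewrite mulgA cX -mulgA at_.
  have fa : a ^+ m * a ^+ d = a ^+ d by exact: triv_exp_mulX.
  have fb : a ^+ m * b ^+ d = b ^+ d by rewrite ab triv_exp_mulX.
  (* Cancelling [a ^+ r] and then [b ^+ k] reduces the collision to [a ^+ d = b ^+ d]. *)
  rewrite -/r expgnDr mulgA -!cX -mulgA -(subnKC (ltnW kl)) -/d expgnDr.
  move=> /(triv_exp_mulI (fixX _ fa) (fixX _ fb)).
  move=> /(triv_exp_mulI _ _) E; apply: nab.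
  apply: (coset_exp_coprime (d := d)) => //; last by apply: cop => //; lia.
  by apply/esym/E; rewrite -ab.
move=> k l; rewrite !inE => kp lp E.
have [kl|lk|//] := ltngtP k l; first by case: (H k l).
by case: (H l k).
Qed.
End Coset.

(** In additive notation with origin [a], the fourth element is [b + c], unless this is 0. In that
    case [c = -b] and [2b] serves: [2b = -b] would mean [3b = 0], which is impossible as 3 is
    coprime to [m]. *)
Lemma coset_fourth a b c : A a -> A b -> A c ->
    (forall s, is_product A m.+1 s -> A s) ->
    a ^+ m = c ^+ m -> b ^+ m = c ^+ m -> a != b -> a != c -> b != c ->
    ~~ (3 %| m) ->
  exists d, [/\ A d, d != a, d != b & d != c].
Proof.
move=> Aa Ab Ac Aprod ac bc /eqP nab /eqP nac /eqP nbc m3.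
have ab : a ^+ m = b ^+ m by rewrite ac.
have Ad x : A x -> A (b * x * a ^+ m.-1).
  move=> Ax; apply: Aprod; have -> : m.+1 = (2 + m.-1)%N by lia.
  apply: is_productM; last exact: is_productX.
  by exists b, (x * 1); rewrite mulg1; split=> //; exists x, 1; rewrite mulg1.
have dE x y : A x -> a ^+ m = x ^+ m -> b * x * a ^+ m.-1 = y -> b * x = y * a.
  move=> Ax ax <-; rewrite -[RHS]mulgA -expgSr prednK ?(ltnW m_gt1)//.
  by rewrite -mulgA ax triv_mul_exp.
have [bca|nbca] := eqVneq (b * c * a ^+ m.-1) a; last first.
  exists (b * c * a ^+ m.-1); split=> //; [exact: Ad| |];
    apply/eqP => /(dE _ _ Ac ac).
    by move/(triv_mulI Ac Aa bc (esym ab)) => E; apply: nac.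
  rewrite (triv_commute Ab Ac bc) => /(triv_mulI Ab Aa (esym bc) (esym ac)) E.
  exact: nab.
have {}bca := dE _ _ Ac ac bca.
exists (b * b * a ^+ m.-1); split; [exact: Ad|..]; apply/eqP => /(dE _ _ Ab ab).
- by rewrite -bca => /(triv_mulI Ab Ac erefl bc).
- by move/(triv_mulI Ab Aa erefl (esym ab)) => E; apply: nab.
move=> bb; apply: nab; apply: (coset_exp_coprime Aa Ab ab (d := 3)) => //.
  by rewrite !expgSS expg1 bb mulgA bca -mulgA.
by rewrite prime_coprime.
Qed.

End Fixed.
End ProductsInMonoids.

(** * The monoid of self-maps of a type *)

(* Composition is taken in diagrammatic order. *)
Definition endo (T : Type) := T -> T.

Section EndoMonoid.
Variable T : Type.
HB.instance Definition _ := gen_eqMixin (endo T).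
HB.instance Definition _ := gen_choiceMixin (endo T).

Definition endo_mul (f g : endo T) : endo T := fun t => g (f t).

Fact endo_mulA : associative endo_mul. Proof. by []. Qed.
Fact endo_mul1f : left_id (id : endo T) endo_mul. Proof. by []. Qed.
Fact endo_mulf1 : right_id (id : endo T) endo_mul. Proof. by []. Qed.
HB.instance Definition _ := isMonoid.Build (endo T) endo_mulA endo_mul1f endo_mulf1.
End EndoMonoid.

Lemma dropl_cat (T : Type) k (s t : seq T) :
  k <= size s -> drop k (s ++ t) = drop k s ++ t.
Proof. by move=> ks; rewrite -{1}(cat_take_drop k s) -catA drop_size_cat ?size_takel. Qed.

(** * Post's coset theorem: embedding an associative operation in a monoid *)

Section PostCover.
Variables (X : Type) (n : nat) (F : n.-tuple X -> X) (x0 : X).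

Definition seq_op (w : seq X) : X := F [tuple nth x0 w i | i < n].

Lemma seq_opE (t : n.-tuple X) : seq_op t = F t.
Proof. by congr F; apply: eq_from_tnth => i; rewrite tnth_mktuple -tnth_nth. Qed.

Lemma nestE (x : nat -> X) i : i < n ->
  nest F x i = mkseq x i ++ F [tuple x (i + l) | l < n]
                 :: mkseq (fun j => x (i + n + j)) (n.-1 - i) :> seq X.
Proof.
move=> lin; apply: (@eq_from_nth _ x0).
  by rewrite size_tuple size_cat /= !size_mkseq; lia.
rewrite size_tuple => j jn.
rewrite (_ : nth _ _ j = tnth (nest F x i) (Ordinal jn)); last by rewrite (tnth_nth x0).
rewrite tnth_mktuple nth_cat size_mkseq /=.
case: ltnP => ij; first by rewrite nth_mkseq.
case: eqP => [->|ji]; first by rewrite subnn.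
have [k jE] : exists k, j = i + k.+1 by exists (j - i).-1; lia.
rewrite jE addKn /= nth_mkseq; last by lia.
by congr x; lia.
Qed.

Hypotheses (n_gt2 : 2 < n) (Fassoc : nary_associative F).

Lemma nest_first x i : i < n -> F (nest F x i) = F (nest F x 0).
Proof. by elim: i => // i IH lin; rewrite -Fassoc // IH // ltnW. Qed.

(** Both sides nest [F] in the same word of length [2n - 1], and associativity makes the position of
    the inner block irrelevant. *)
Lemma seq_op_assoc (u y v : seq X) : size u + size v = n.-1 -> size y = n ->
  seq_op (u ++ seq_op y :: v) =
  seq_op (seq_op (take n (u ++ y ++ v)) :: drop n (u ++ y ++ v)).
Proof.
move=> uv yn; pose x := nth x0 (u ++ y ++ v).
have un : size u < n by lia.
have E u' y' v' : size y' = n -> size u' + size v' = n.-1 ->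
    u' ++ y' ++ v' = u ++ y ++ v ->
    seq_op (u' ++ seq_op y' :: v') = F (nest F x (size u')).
  move=> yn' uv' E; rewrite -seq_opE nestE; last by lia.
  have xE s t r : s ++ t ++ r = u ++ y ++ v ->
      mkseq (fun j => x (size s + j)) (size t) = t.
    rewrite /x => <-; apply: (@eq_from_nth _ x0); rewrite size_mkseq // => j jt.
    by rewrite nth_mkseq // nth_cat ltnNge leq_addr /= addKn nth_cat jt.
  have <- : seq_op y' = F [tuple x (size u' + l) | l < n].
    congr F; apply: eq_from_tnth => j; rewrite !tnth_mktuple.
    by rewrite -{1}(xE _ _ _ E) nth_mkseq // yn'.
  congr (seq_op (_ ++ _ :: _)).
    by rewrite -[LHS](xE [::] u' (y' ++ v')).
  rewrite -[LHS](xE (u' ++ y') v' [::]); last by rewrite cats0 -catA.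
  by rewrite size_cat yn'; congr mkseq; lia.
set w := u ++ y ++ v.
have wn : size w = n + n.-1 by rewrite /w !size_cat; lia.
rewrite (E u y v) // nest_first // -(E [::] (take n w) (drop n w)) //=.
- by rewrite size_takel // wn leq_addr.
- by rewrite size_drop wn addKn.
- by rewrite cat_take_drop.
Qed.

(** Left-normed evaluation, with the result kept as a word: a single letter when [w] has length
    [k * n.-1 + 1]. *)
Fixpoint eval k (w : seq X) : seq X :=
  if k is k'.+1 then eval k' (seq_op (take n w) :: drop n w) else w.

Lemma evalS_cat k (w v : seq X) : size w = n ->
  eval k.+1 (w ++ v) = eval k (seq_op w :: v).
Proof. by move=> wn /=; rewrite take_size_cat ?drop_size_cat. Qed.

(** If [u] has at least [n] letters, the first application takes place inside [u] and induction
    applies. Otherwise [y] lies within the first [2n - 1] letters, where [seq_op_assoc] moves the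
    inner application to the front. *)
Lemma eval_inner k (u y v : seq X) :
    size (u ++ y ++ v) = k.+1 * n.-1 + 1 -> size y = n ->
  eval k.+1 (u ++ y ++ v) = eval k (u ++ seq_op y :: v).
Proof.
elim: k u v => [|k IH] u v; rewrite !size_cat => sz yn.
  have [-> ->] : u = [::] /\ v = [::].
    by split; apply/nilP; rewrite /nilp; lia.
  by rewrite /= cats0 take_oversize ?drop_oversize ?yn.
have [nu|un] := leqP n (size u).
  have -> : eval k.+2 (u ++ y ++ v)
      = eval k.+1 ((seq_op (take n u) :: drop n u) ++ y ++ v).
    by rewrite /= takel_cat // dropl_cat.
  by rewrite IH ?size_cat /= ?size_drop ?takel_cat ?dropl_cat //; lia.
pose v1 := take (n.-1 - size u) v; pose v2 := drop (n.-1 - size u) v.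
have vE : v = v1 ++ v2 by rewrite cat_take_drop.
have v1n : size v1 = n.-1 - size u by rewrite size_takel //; lia.
rewrite {1 2}vE.
have [w wE] : exists w, w = u ++ y ++ v1 by exists (u ++ y ++ v1).
have wn : size w = n + n.-1 by rewrite wE !size_cat v1n; lia.
have -> : u ++ y ++ v1 ++ v2 = w ++ v2 by rewrite wE -!catA.
have -> : u ++ seq_op y :: v1 ++ v2 = (u ++ seq_op y :: v1) ++ v2 by rewrite -catA.
have sn : size (u ++ seq_op y :: v1) = n by rewrite size_cat /= v1n; lia.
have tn : size (take n w) = n by rewrite size_takel // wn leq_addr.
have dn : size (drop n w) = n.-1 by rewrite size_drop wn addKn.
rewrite [RHS]evalS_cat // -{1}(cat_take_drop n w) -catA evalS_cat // -cat_cons.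
rewrite evalS_cat /= ?dn ?prednK ?(ltnW (ltnW n_gt2)) //.
by rewrite wE -seq_op_assoc // v1n; lia.
Qed.

(* Only words of length 1 modulo [n.-1] have a value; the others get [[::]]. *)
Definition value (w : seq X) : seq X :=
  if size w %% n.-1 == 1 then eval (size w %/ n.-1) w else [::].

(** Letting letters act on these functions takes the place of a quotient of the free monoid. *)
Definition compatible (g : seq X -> seq X) : Prop :=
  forall u y v : seq X, size y = n -> g (u ++ y ++ v) = g (u ++ seq_op y :: v).

Lemma value_compatible : compatible value.
Proof.
move=> u y v yn; rewrite /value.
have m0 : 0 < n.-1 by lia.
have sz : size (u ++ y ++ v) = size (u ++ seq_op y :: v) + n.-1.
  by rewrite !size_cat /= yn; lia.
rewrite sz modnDr divnDr ?dvdnn // divnn m0 addn1.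
case: eqP => // s1; apply: eval_inner => //.
have := divn_eq (size (u ++ seq_op y :: v)) n.-1.
by rewrite s1 sz; lia.
Qed.

Lemma value1 x : value [:: x] = [:: x].
Proof. by rewrite /value /= modn_small ?divn_small //; lia. Qed.

(* Letters act on functions of words by prefixing, so that products of letters
   act by concatenation. *)
Let word_fun := {g : seq X -> seq X | compatible g}.

Fact shift_subproof x (g : word_fun) : compatible (fun w => sval g (x :: w)).
Proof. by move=> u y v yn; apply: (proj2_sig g (x :: u)). Qed.

Definition shift (x : X) : endo word_fun := fun g => exist _ _ (shift_subproof x g).

(** Evaluating at [value] and the empty word recovers the letter, whence injectivity. The product of
    the letters of [t] prefixes [t], which compatibility turns into prefixing [F t]. *)
Lemma post_cover : exists (S : monoidType) (i : X -> S),
  injective i /\ forall t : n.-tuple X, i (F t) = (\prod_(j < n) i (tnth t j))%g.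
Proof.
exists (endo word_fun), shift; split.
  move=> x y /(congr1 (fun f : endo word_fun =>
    sval (f (exist _ _ value_compatible)) [::])).
  by rewrite /= !value1 => -[].
move=> t.
have prodE (s : seq X) g w : sval ((\prod_(x <- s) shift x)%g g) w = sval g (s ++ w).
  elim: s g w => [|x s IH] g w; first by rewrite big_nil.
  by rewrite big_cons /= [LHS]IH.
rewrite -(big_tuple _ _ t xpredT shift).
apply: funext => g; apply: eq_sig_hprop; first by move=> *; exact: Prop_irrelevance.
apply: funext => w; rewrite prodE /= -seq_opE.
by rewrite (proj2_sig g [::]) // size_tuple.
Qed.

End PostCover.

(** * Transfer of the hypotheses on [F] to the monoid *)

Lemma prodg_const_but (S : monoidType) (a b : S) n k : k < n ->
  (\prod_(j < n) (if j == k :> nat then b else a) = a ^+ k * b * a ^+ (n.-1 - k))%g.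
Proof.
move=> kn; rewrite -(big_mkord xpredT (fun j => if j == k then b else a)).
rewrite (@big_cat_nat _ _ _ k) //=; last exact: ltnW.
rewrite [X in (_ * X)%g]big_ltn // eqxx mulgA.
have cst l r : (forall j, l <= j < r -> j != k) ->
    (\prod_(l <= j < r) (if j == k then b else a) = a ^+ (r - l))%g.
  move=> jk; rewrite (eq_big_nat _ _ (F2 := fun=> a)) ?prodg_const_nat //.
  by move=> j /jk /negbTE ->.
rewrite !cst ?subn0; first by congr (_ * _ ^+ _)%g; lia.
- by move=> j ?; lia.
- by move=> j ?; lia.
Qed.

Lemma is_product_range (S : monoidType) (X : Type) (i : X -> S) k (s : S) :
  is_product (range i) k s ->
  exists t : k.-tuple X, s = (\prod_(j < k) i (tnth t j))%g.
Proof.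
elim: k s => [s ->|k IH s [_ [s' [[x _ <-] /IH [t ->] ->]]]].
  by exists [tuple]; rewrite big_ord0.
exists [tuple of x :: t]; rewrite big_ord_recl tnth0; congr (_ * _)%g.
by apply: eq_bigr => j _; rewrite tnthS.
Qed.

(** The three distinct elements come from a tuple whose value is none of its entries: [a] and [b]
    are two of its entries and [c] is the value. *)
Lemma opclass_cover (X : Type) (n : nat) (F : n.-tuple X -> X) (x0 : X) :
    2 < n -> opclass X n n.-1 F -> ~ opclass X n 1 F ->
  exists (S : monoidType) (i : X -> S),
    [/\ injective i, near_constant_trivial n.-1 (range i),
      forall s, is_product (range i) n s -> range i s
    & exists a b c, (i a ^+ n.-1 = i c ^+ n.-1 /\ i b ^+ n.-1 = i c ^+ n.-1)%g
                    /\ [/\ i a != i b, i a != i c & i b != i c]].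
Proof.
move=> n2 [Fassoc Ftriv] Fnot.
have [S [i [i_inj iF]]] := post_cover x0 n2 Fassoc.
have n_gt0 : 0 < n by lia.
have Ai : near_constant_trivial n.-1 (range i).
  move=> _ _ k [a _ <-] [b _ <-] kn; have kn' : k < n by lia.
  (* A tuple constant off position [k] has [n.-1] equal entries. *)
  pose t := [tuple if j == k :> nat then b else a | j < n].
  have -> : (i a ^+ k * i b * i a ^+ (n.-1 - k))%g = i (F t).
    rewrite iF -prodg_const_but //; apply: eq_bigr => j _.
    by rewrite tnth_mktuple; case: ifP.
  have [|j ->] := Ftriv t.
    exists [set~ Ordinal kn']%SET; first by rewrite cardsC1 card_ord.
    move=> j l; rewrite !inE !tnth_mktuple -!val_eqE /=.
    by move=> /negbTE -> /negbTE ->.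
  by rewrite tnth_mktuple; case: ifP; [right|left].
have Aprod s : is_product (range i) n s -> range i s.
  by move=> /is_product_range [t ->]; rewrite -iF; exists (F t).
exists S, i; split=> //.
have [t nt] : exists t : n.-tuple X, ~ exists j, F t = tnth t j.
  by apply: contrapT => H; apply: Fnot; split=> // t _; apply: contrapT => nt;
    apply: H; exists t.
pose P := [set i (tnth t j) | j in [set: 'I_n]].
have n1 : 1 < n.-1 by lia.
have [||||s1 [s2 [[a _ <-] [b _ <-] [ag bg] [ab ac bc]]]] :=
    @nontrivial_product _ _ _ n1 Ai P (i (F t)).
- by move=> _ [j _ <-]; exists (tnth t j).
- by exists (F t).
- by rewrite prednK // iF; apply: is_product_ord => j; exists j.
- by move=> [j _ /i_inj E]; apply: nt; exists j.
by exists a, b, (F t).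
Qed.

(** * Lower bounds on the cardinality of [X] *)

Lemma card_at_leastP (X : Type) (x0 : X) k :
  card_at_least X k <-> exists f : nat -> X, {in `I_k &, injective f}.
Proof.
pose Y : pointedType :=
  HB.pack X (gen_eqMixin X) (gen_choiceMixin X) (isPointed.Build X x0).
exact: iff_sym (rwP (@pcard_injP nat Y `I_k)).
Qed.

Lemma card_at_least_le (X : Type) k l : k <= l -> card_at_least X l -> card_at_least X k.
Proof. by move=> kl; apply: card_le_trans; rewrite card_le_II. Qed.

Lemma card_at_least_image (X : Type) (S : eqType) (i : X -> S) (s : seq S) :
  0 < size s -> uniq s -> (forall x, x \in s -> range i x) -> card_at_least X (size s).
Proof.
case: s => // x s _ us si; have [x0 _ _] := si x (mem_head _ _).
have [k|f fE] := @choice nat X (fun k y => k < size (x :: s) -> i y = nth x (x :: s) k).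
  have [ks|] := ltnP k (size (x :: s)); last by exists x0.
  by have [y _ yE] := si _ (mem_nth x ks); exists y.
apply/(card_at_leastP x0); exists f => k l; rewrite !inE => ks ls.
move=> /(congr1 i); rewrite !fE // => /eqP.
by rewrite nth_uniq // => /eqP.
Qed.

(** The first [p] multiples of [b] with origin [a] are distinct, and each is a product of [n]
    elements of the image of [X], hence lies in that image. *)
Lemma opclass_card_coprime (X : Type) (n p : nat) (F : n.-tuple X -> X) (x0 : X) :
    2 < n -> opclass X n n.-1 F -> ~ opclass X n 1 F -> p <= n ->
    (forall d, 0 < d -> d < p -> coprime d n.-1) ->
  card_at_least X p.
Proof.
move=> n2 Fk F1 pn cop.
have [S [i [i_inj Ai Aprod [a [b [c [[ac bc] [ab _ _]]]]]]]] :=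
  opclass_cover x0 n2 Fk F1.
case: p pn cop => [|p] pn cop.
  by apply: (@card_at_least_le _ 0 0) => //; rewrite /card_at_least II0; apply: card_ge0.
have n1 : 1 < n.-1 by lia.
have Ra : range i (i a) by exists a.
have Rb : range i (i b) by exists b.
pose s := [seq (i b ^+ k * i a ^+ (n.-1.+1 - k))%g | k <- iota 0 p.+1].
rewrite -[p.+1](_ : size s = _); last by rewrite size_map size_iota.
apply: (@card_at_least_image _ _ i).
- by rewrite size_map.
- rewrite map_inj_in_uniq ?iota_uniq // => k l.
  rewrite !mem_iota /= !add0n => kp lp.
  apply: (coset_multiples_inj n1 Ai Ra Rb _ ab _ cop); rewrite ?inE //.
    by rewrite ac bc.
  by lia.
move=> _ /mapP [k + ->]; rewrite mem_iota /= add0n => kp.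
have nE : n = k + (n.-1.+1 - k) by lia.
apply: Aprod; rewrite [X in is_product _ X]nE.
by apply: is_productM; apply: is_productX.
Qed.

Lemma opclass_card4 (X : Type) (n : nat) (F : n.-tuple X -> X) (x0 : X) :
    2 < n -> opclass X n n.-1 F -> ~ opclass X n 1 F -> ~~ (3 %| n.-1) ->
  card_at_least X 4.
Proof.
move=> n2 Fk F1 n3.
have [S [i [i_inj Ai Aprod [a [b [c [[ac bc] [ab nac nbc]]]]]]]] :=
  opclass_cover x0 n2 Fk F1.
have n1 : 1 < n.-1 by lia.
have Ra x : range i (i x) by exists x.
have [|d [Rd da db dc]] :=
    coset_fourth n1 Ai (Ra a) (Ra b) (Ra c) _ ac bc ab nac nbc n3.
  by rewrite prednK //; lia.
apply: (@card_at_least_image _ _ i [:: d; i a; i b; i c]) => //.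
  by rewrite /= !inE !negb_or da db dc ab nac nbc.
by move=> x; rewrite !inE => /or4P [] /eqP ->.
Qed.

(** * The operation built from a group and left zeros *)

Section GroupWithZeros.
Variables (X : Type) (V : zmodType) (f : V -> X) (g : X -> option V).
Hypotheses (fK : pcancel f g) (gK : ocancel g f).

(* The group [f @` V] to which the other points of [X] are adjoined as a
   left-zero ideal. *)
Definition zmul (x y : X) : X :=
  match g x, g y with
  | Some u, Some v => f (u + v)%R
  | Some _, None => y
  | None, _ => x
  end.

Lemma zmulA : associative zmul.
Proof.
move=> x y z; rewrite /zmul.
case gx: (g x) => [u|]; case gy: (g y) => [v|]; case gz: (g z) => [w|];
  by rewrite ?fK ?gx ?gy ?gz ?GRing.addrA.
Qed.

Lemma zmul_left_id : left_id (f 0%R) zmul.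
Proof.
move=> x; rewrite /zmul fK; case gx: (g x) => [u|//].
by rewrite GRing.add0r -[RHS]gK gx.
Qed.

Definition zfold (s : seq X) : X := foldr zmul (f 0%R) s.

Lemma zfold_cons x s : zfold (x :: s) = zmul x (zfold s). Proof. by []. Qed.

Lemma zfold_cat s t : zfold (s ++ t) = zmul (zfold s) (zfold t).
Proof.
elim: s => [|x s IH]; first by rewrite zmul_left_id.
by rewrite cat_cons !zfold_cons IH zmulA.
Qed.

Lemma zfold_map (s : seq V) : zfold (map f s) = f (\sum_(v <- s) v)%R.
Proof.
elim: s => [|v s IH]; first by rewrite big_nil.
by rewrite big_cons map_cons zfold_cons IH /zmul !fK.
Qed.

(** The fold is the first entry outside the group: group entries before it leave it unchanged, and
    it absorbs all that follows. The induction also records that the fold is then outside the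
    group. *)
Lemma zfoldP (s : seq X) :
  (exists2 j, j < size s & zfold s = nth (f 0%R) s j) \/ exists s', s = map f s'.
Proof.
suff [s'|[j js [-> _]]] : (exists s', s = map f s') \/
    (exists2 j, j < size s & zfold s = nth (f 0%R) s j /\ g (zfold s) = None).
- by right.
- by left; exists j.
elim: s => [|x s IH]; first by left; exists [::].
case gx: (g x) => [u|]; last first.
  by right; exists 0; rewrite // zfold_cons /zmul gx.
have xE : x = f u by rewrite -[LHS]gK gx.
case: IH => [[s' ->]|[j js [sE gs]]]; first by left; exists (u :: s'); rewrite xE.
by right; exists j.+1; rewrite // zfold_cons /zmul gx gs.
Qed.

Variable n : nat.

Definition zop (t : n.-tuple X) : X := zfold t.

Lemma zop_assoc : nary_associative zop.
Proof.
move=> x i lin.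
(* Every nesting folds the whole word of length [2n - 1]. *)
suff E j : j < n -> zop (nest zop x j) = zfold (mkseq x (n + n.-1)).
  by rewrite !E // ltnW.
move=> jn; rewrite /zop (nestE _ (f 0%R)) // zfold_cat zfold_cons -!zfold_cat.
congr zfold; apply: (@eq_from_nth _ (f 0%R)).
  by rewrite !size_cat !size_mkseq size_tuple; lia.
rewrite !size_cat !size_mkseq size_tuple => k kn.
rewrite !nth_cat size_mkseq size_tuple [RHS]nth_mkseq; last by lia.
case: ltnP => jk; first by rewrite nth_mkseq.
case: ltnP => jkn; last by rewrite nth_mkseq; [congr x|]; lia.
rewrite -[nth _ _ _](tnth_nth (f 0%R) _ (Ordinal jkn)) tnth_mktuple /=.
by congr x; lia.
Qed.

Hypothesis n_gt2 : 2 < n.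

(** If all entries lie in the group, the [n.-1] equal ones add up to 0 and the remaining one is the
    value. *)
Lemma zop_near_const (t : n.-tuple X) : (forall v : V, v *+ n.-1 = 0)%R ->
  at_least_equal n.-1 t -> exists i, zop t = tnth t i.
Proof.
move=> Vn [A An At].
have [[j jt E]|[s tE]] := zfoldP t.
  rewrite size_tuple in jt; exists (Ordinal jt).
  by rewrite (tnth_nth (f 0%R)).
have sn : size s == n by rewrite -(size_map f) -tE size_tuple.
pose c i := tnth (Tuple sn) i.
have tE' : t = map_tuple f (Tuple sn) by apply: val_inj.
have f_inj : injective f by exact: pcan_inj fK.
have [j jc] : exists j, {in [set~ j]%SET &, forall i k, c i = c k}.
  (* [A] is everything or omits a single index [j]; in the first case any [j] will do. *)
  have [[j jA]|AT] := pselect (exists j, j \notin A); last first.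
    have AT' i : i \in A by apply: contraT => iA; case: AT; exists i.
    exists (Ordinal (ltnW (ltnW n_gt2))) => i k _ _; apply: f_inj.
    by have := At i k (AT' i) (AT' k); rewrite tE' !tnth_map.
  have AE : A = [set~ j]%SET.
    apply/eqP; rewrite eqEcard cardsC1 card_ord An andbT.
    by apply/fintype.subsetP => i iA; rewrite !inE; apply: contraNneq jA => <-.
  exists j => i k; rewrite -AE => iA kA; apply: f_inj.
  by have := At i k iA kA; rewrite tE' !tnth_map.
exists j; rewrite {2}tE' tnth_map /zop tE' zfold_map big_tuple; congr f.
rewrite (bigD1 j) //=.
have [l lj] : exists l, l \in [set~ j]%SET.
  by apply/set0Pn; rewrite -card_gt0 cardsC1 card_ord; lia.
rewrite (eq_bigr (fun=> c l)); last by move=> i ij; apply: (jc i l _ lj); rewrite !inE.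
rewrite GRing.sumr_const (_ : #|_| = n.-1) ?Vn ?GRing.addr0 //.
have := cardsC1 j; rewrite card_ord => <-.
by apply: eq_card => i; rewrite !inE.
Qed.

(** The tuple [a, b, 0, ..., 0] has value [a + b]. *)
Lemma zop_not_quasitrivial (a b : V) :
  (a + b)%R \notin [:: 0; a; b]%R -> ~ opclass X n 1 zop.
Proof.
move=> nab [_ H].
have sn : size (map f (a :: b :: nseq n.-2 0%R)) == n.
  by rewrite size_map /= size_nseq; lia.
have [|i] := H (Tuple sn).
  exists [set Ordinal (ltnW (ltnW n_gt2))]%SET; first by rewrite cards1.
  by move=> i k; rewrite !inE => /eqP -> /eqP ->.
rewrite /zop zfold_map !big_cons big_nseq GRing.iter_addr_0 GRing.mul0rn GRing.addr0.
rewrite (tnth_nth (f 0%R)) (nth_map 0%R); last first.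
  by rewrite -(size_map f) (eqP sn).
move=> /(pcan_inj fK) E; move: nab; rewrite E => /negP; apply.
have : nth 0%R (a :: b :: nseq n.-2 0%R) i \in a :: b :: nseq n.-2 0%R.
  by apply: mem_nth; rewrite -(size_map f) (eqP sn).
by rewrite !inE mem_nseq => /or3P [->|->|/andP[_ ->]]; rewrite ?orbT.
Qed.

End GroupWithZeros.

(** * Examples from cyclic groups and the Klein four-group *)

Lemma card_at_least_fin (X : Type) (x0 : X) (T : finType) :
  card_at_least X #|T| -> exists f : T -> X, injective f.
Proof.
move=> /(card_at_leastP x0) [h h_inj]; exists (fun v => h (enum_rank v)).
by move=> u v /h_inj E; apply: enum_rank_inj; apply: ord_inj; apply: E; rewrite inE /=.
Qed.

Lemma opclass_group (X : Type) (V : zmodType) (f : V -> X) (n : nat) (a b : V) :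
    injective f -> 2 < n ->
    (forall v : V, v *+ n.-1 = 0)%R -> (a + b)%R \notin [:: 0; a; b]%R ->
  opclass X n n.-1 `\` opclass X n 1 !=set0.
Proof.
move=> f_inj n2 Vn nab.
have [x|g gP] := @choice X (option V)
    (fun x o => oapp f x o = x /\ forall v, f v = x -> o = Some v).
  have [[v <-]|nv] := pselect (exists v, f v = x).
    by exists (Some v); split=> // u /f_inj ->.
  by exists None; split=> // v vx; case: nv; exists v.
have fK : pcancel f g by move=> v; case: (gP (f v)) => _; apply.
have gK : ocancel g f by move=> x; case: (gP x).
exists (zop f g (n := n)); split.
  by split; [exact: zop_assoc | move=> t; exact: zop_near_const].
exact: (zop_not_quasitrivial fK n2 nab).
Qed.

(** In Z/p with [a = b = 1], the sum 2 is neither 0 nor 1 because [p > 2]. *)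
Lemma opclass_cyclic (X : Type) (x0 : X) (n p : nat) :
    2 < n -> 2 < p -> p %| n.-1 -> card_at_least X p ->
  opclass X n n.-1 `\` opclass X n 1 !=set0.
Proof.
move=> n2 p2 pn Xp; have p1 := ltnW p2.
have [|f f_inj] := @card_at_least_fin X x0 'Z_p; first by rewrite card_ord Zp_cast.
apply: (opclass_group (a := 1%R) (b := 1%R) f_inj n2).
- by move=> v; rewrite -GRing.mulr_natr -(Zp_nat_mod p1) (eqP pn) GRing.mulr0.
- have two_neq0 : (2%:R != 0 :> 'Z_p)%R.
    by rewrite -val_eqE [val _](val_Zp_nat p1) modn_small.
  rewrite !inE orbb -[X in _ || (_ == X)]GRing.addr0 (inj_eq (GRing.addrI _)).
  by rewrite GRing.oner_eq0 orbF.
Qed.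

(** For odd [n] the even number [n.-1] kills (Z/2)^2, where two distinct nonzero elements sum to the
    third. *)
Lemma opclass_klein (X : Type) (x0 : X) (n : nat) : 2 < n -> odd n ->
  card_at_least X 4 -> opclass X n n.-1 `\` opclass X n 1 !=set0.
Proof.
move=> n2 on X4.
have [|f f_inj] := @card_at_least_fin X x0 ('Z_2 * 'Z_2)%type.
  by rewrite card_prod !card_ord.
apply: (opclass_group (a := (1%R, 0%R)) (b := (0%R, 1%R)) f_inj n2) => //.
move=> v; have -> : n.-1 = 2 * (n.-1)./2 by lia.
  rewrite GRing.mulrnA (_ : (v *+ 2)%R = 0%R) ?GRing.mul0rn //.
  by case: v => -[[|[|//]] ?] [[|[|//]] ?]; congr pair; apply: val_inj.
Qed.

Theorem corollary1p11 (X : Type) (hX : card_at_least X 3)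
    (n : nat) (hn : 3 <= n) (p : nat) (hp : is_critical n p) :
  (~~ odd n ->
     (opclass X n n.-1 `\` opclass X n 1 !=set0 <-> card_at_least X p)) /\
  (odd n ->
     (opclass X n n.-1 `\` opclass X n 1 !=set0 <->
      card_at_least X (minn 4 p))).
Proof.
have [x0 _] : exists x0 : X, True.
  apply: contrapT => noX; have : [set: X] = set0.
    by rewrite -subset0 => x _; apply: noX; exists x.
  by move: hX; rewrite /card_at_least => + X0; rewrite X0 =>
    /card_le0P /seteqP [/(_ 0 isT)].
have [hp_odd hp_pow2] := hp.
have p_cyclic : least_odd_prime_divisor n.-1 p -> card_at_least X p ->
    opclass X n n.-1 `\` opclass X n 1 !=set0.
  by move=> [pp po pn _]; apply: opclass_cyclic => //; exact: odd_prime_gt2.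
split=> n_odd.
  have [|pp po pn pmin] := hp_odd.
    (* For even [n], [n.-1] is odd and at least 3, hence not a power of 2. *)
    by move=> [e ne]; have := n_odd; rewrite -(prednK (ltnW (ltnW hn))) ne;
      case: e ne => [|e] ne; rewrite ?oddS ?oddX /=; lia.
  split=> [[F [Fk F1]]|]; last exact: p_cyclic.
  apply: (opclass_card_coprime x0 hn Fk F1).
    by have := dvdn_leq _ pn; lia.
  (* If [d] is not coprime to the odd number [n.-1], they share an odd prime, which is at least [p]
     and at most [d]. *)
  move=> d d0 dp; rewrite /coprime; apply: contraTT dp => g1; rewrite -leqNgt.
  have g2 : 1 < gcdn d n.-1 by have := gcdn_gt0 d n.-1; lia.
  have qg := pdiv_dvd (gcdn d n.-1).
  apply: leq_trans (dvdn_leq d0 (dvdn_trans qg (dvdn_gcdl _ _))).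
  have qn := dvdn_trans qg (dvdn_gcdr _ _).
  apply: pmin => //; first exact: pdiv_prime.
  by apply: dvdn_odd qn _; lia.
split=> [[F [Fk F1]]|].
  have [n3|n3] := boolP (3 %| n.-1); last first.
    exact: card_at_least_le (geq_minl _ _) (opclass_card4 x0 hn Fk F1 n3).
  have [|pp po pn pmin] := hp_odd.
    by move=> [e ne]; move: n3; rewrite ne Euclid_dvdX.
  (* As 3 divides [n.-1], minimality gives [p <= 3], and [X] has at least three elements. *)
  by apply: card_at_least_le hX; rewrite geq_min pmin ?orbT.
have [p4|p4] := leqP 4 p; last first.
  (* Powers of 2 have [p = 4], so [p < 4] leaves only the cyclic case. *)
  by apply/p_cyclic/hp_odd => /hp_pow2; lia.
exact: opclass_klein.
Qed.
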